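(* Let $d \in \mathbb{N}$, let $M \ge 8$, and let $\{t_j\}_{j\in\mathbb{N}}$ be a sequence of positive real numbers with $t_1 \ge 2$ and $$\frac{t_{j+1}}{t_j} \ge 1+\frac{1}{M} \quad \text{for all } j \in \mathbb{N}.$$ Then there exist real numbers $\alpha_1,\dots,\alpha_d$ such that $$\max_{1\le k\le d} \|\alpha_k t_j\| \ge \frac{1}{2^{11}(M\log M)^{1/d}} \quad \text{for all } j\in\mathbb{N}.$$
   Context: For a real number $x$, $\|x\|$ denotes the distance from $x$ to the nearest integer. *)

(* Defs.v *)
From HB Require Import structures.
From mathcomp Require Import all_boot all_order all_algebra.
From mathcomp Require Import all_classical all_reals all_analysis.

Set Implicit Arguments.
Unset Strict Implicit.
Unset Printing Implicit Defensive.

Import Order.TTheory GRing.Theory Num.Theory.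
Local Open Scope classical_set_scope.
Local Open Scope ring_scope.

(* The set is nonempty and bounded below by 0, so [inf] is a true infimum; it
   is attained, at the integer(s) nearest to [x]. *)
Definition dist_int (R : realType) (x : R) : R :=
  inf (range (fun n : int => `|x - n%:~R|)).

(* Main.v *)
(* A Peres-Schlag type argument, carried out on nested grids of cubes. Group the
   indices into consecutive blocks of length h ~ 7 M log M, so long that t grows
   by a factor at least 2/delta over a block, where delta is the claimed lower
   bound. A nested sequence of cubes Q_b is built such that the points of
   Q_(b+1) are good for block b+1, i.e. max_k |x_k t_j| >= delta mod 1 for all j
   in that block. The invariant is that at most half of the subcubes of Q_b
   are bad for block b+1. Since block b+2 oscillates at a scale finer than Q_b,
   each of its h conditions excludes a proportion at most (40 delta)^d of the
   sub-subcubes, and h (40 delta)^d <= 1/4; hence some good subcube of Q_b has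
   at most half of its own subcubes bad for block b+2. *)
Require Import Defs.
From HB Require Import structures.
From mathcomp Require Import all_boot all_order all_algebra.
From mathcomp Require Import all_classical all_reals all_analysis.
From mathcomp Require Import lra ring zify.

Set Implicit Arguments.
Unset Strict Implicit.
Unset Printing Implicit Defensive.

Import Order.TTheory GRing.Theory Num.Theory.
Local Open Scope ring_scope.

(** * Distance to the nearest integer *)

Lemma dist_int_lt (R : realType) (x e : R) :
  dist_int x < e -> exists n : int, `|x - n%:~R| < e.
Proof.
by move=> /inf_lt[|_ [n _ <-] lt_e]; [exists `|x - 0%:~R|, 0|exists n].
Qed.

Lemma dist_int_lipschitz (R : realType) (x y : R) :
  dist_int x <= dist_int y + `|x - y|.
Proof.
rewrite -lerBlDr; apply: lb_le_inf; first by exists `|y - 0%:~R|, 0.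
move=> _ [n _ <-]; rewrite lerBlDr.
have lex : dist_int x <= `|x - n%:~R|.
  apply: ge_inf; last by exists n.
  by exists 0 => _ [m _ <-]; rewrite normr_ge0.
apply: (le_trans lex); rewrite [leRHS]addrC.
have -> : x - n%:~R = (x - y) + (y - n%:~R) by ring.
exact: ler_normD.
Qed.

(** * Counting the terms of an arithmetic progression close to integers *)

Lemma sum_bounded_gap (P : pred nat) (N D : nat) :
    (forall u v, (u < N)%N -> (v < N)%N -> P u -> P v -> (v <= u + D)%N) ->
  (\sum_(0 <= u < N) P u <= D.+1)%N.
Proof.
move=> gapP; set s := [seq u <- index_iota 0 N | P u].
have -> : (\sum_(0 <= u < N) P u)%N = size s.
  rewrite size_filter -sum1_count [RHS]big_mkcond.
  by apply: eq_bigr => i _; case: (P i).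
have [exP|noP] := pselect (exists u, (u < N) && P u)%N.
  case: (ex_minnP exP) => u /andP[uN Pu] minu.
  rewrite -(size_iota u D.+1); apply: uniq_leq_size.
    by rewrite filter_uniq ?iota_uniq.
  move=> v; rewrite mem_filter mem_index_iota mem_iota => /andP[Pv /= vN].
  by rewrite minu ?vN ?Pv // addnS ltnS gapP.
suff -> : s = [::] by [].
apply/eqP; rewrite -[_ == _]negbK -has_filter; apply/negP => /hasP[v].
by rewrite mem_index_iota => /= vN Pv; apply: noP; exists v; rewrite vN.
Qed.

(** Over the window the progression moves by at most 1/2, and [16 * delta <= 1], so all counted
    terms are close to the same integer. Their indices differ by at most [4 * delta / eta]; the
    extra 1 in the count is absorbed by [eta <= delta]. *)
Lemma near_int_window (R : realType) (delta eta y : R) (K : nat) :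
    0 < eta -> eta <= delta -> 16 * delta <= 1 -> 2 * (K%:R * eta) <= 1 ->
  (\sum_(0 <= u < K) (dist_int (y + u%:R * eta) < 2 * delta)%R)%:R
    <= 5 * delta / eta.
Proof.
move=> eta0 le_eta delta16 Keta.
set D := Num.trunc (4 * delta / eta).
have D0 : 0 <= 4 * delta / eta by rewrite divr_ge0 //; lra.
have leD : D%:R <= 4 * delta / eta by case/andP: (truncn_itv D0).
apply: (@le_trans _ _ D.+1%:R); last first.
  have e1 : 1 <= delta / eta by rewrite ler_pdivlMr // mul1r.
  by rewrite -natr1 -mulrA; move: leD; rewrite -mulrA; lra.
rewrite ler_nat; apply: sum_bounded_gap => u v uK vK /dist_int_lt[n un].
move=> /dist_int_lt[m vm].
have lt_eta w : (w < K)%N -> w%:R * eta <= K%:R * eta.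
  by move=> /ltnW wK; rewrite ler_pM2r // ler_nat.
have ge_eta w : 0 <= w%:R * eta by rewrite mulr_ge0 // ltW.
have := lt_eta _ uK; have := lt_eta _ vK; have := ge_eta u; have := ge_eta v.
move: un vm; rewrite !ltr_norml => /andP[un1 un2] /andP[vm1 vm2] gv gu lv lu.
have nm : n = m.
  have lt1 : (m - n)%:~R < 1%:~R :> R by rewrite intrB; lra.
  have lt2 : (n - m)%:~R < 1%:~R :> R by rewrite intrB; lra.
  by move: lt1 lt2; rewrite !ltr_int; lia.
rewrite -leq_subLR truncn_ge_nat // ler_pdivlMr //.
have [le_uv|/ltnW le_vu] := leqP u v.
  by rewrite natrB // mulrBl -nm in vm1 vm2 *; lra.
by move: le_vu; rewrite -subn_eq0 => /eqP ->; lra.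
Qed.

(* Cut [0, N) into windows of K ~ 1 / (2 eta) indices: over a window the
   progression moves by at most 1/2, so it approaches a single integer. *)
Lemma near_int_count (R : realType) (delta eta y : R) (N : nat) :
    0 < eta -> eta <= delta -> 16 * delta <= 1 -> 1 <= N%:R * eta ->
  (\sum_(0 <= u < N) (dist_int (y + u%:R * eta) < 2 * delta)%R)%:R
    <= 40 * delta * N%:R.
Proof.
move=> eta0 le_eta delta16 Neta.
set K := Num.trunc (2 * eta)^-1.
have e2 : 0 <= (2 * eta)^-1 by rewrite invr_ge0; lra.
have /andP[K1 K2] : K%:R <= (2 * eta)^-1 < K.+1%:R by exact: truncn_itv.
have Keta : 2 * (K%:R * eta) <= 1.
  by rewrite mulrCA -ler_pdivlMr ?mulr_gt0 // mul1r.
have Keta4 : 1 <= 4 * (K%:R * eta).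
  have : 1 < K.+1%:R * (2 * eta).
    by rewrite -ltr_pdivrMr ?mulr_gt0 // mul1r.
  by rewrite -natr1; lra.
have K0 : (0 < K)%N.
  by rewrite lt0n; apply/eqP => K0; move: Keta4; rewrite K0; lra.
(* The last window may overshoot [N], but [K <= N] keeps the covered range within [2 * N]. *)
set W := (N %/ K).+1.
have NWK : (N <= W * K)%N by rewrite ltnW // ltn_ceil.
have WKN : (W * K <= 2 * N)%N.
  have KN : (K <= N)%N by rewrite -(ler_nat R) -(ler_pM2r eta0); lra.
  by rewrite /W [(_ * K)%N]mulSn mul2n -addnn leq_add // leq_divM.
set F := fun u : nat => nat_of_bool (dist_int (y + u%:R * eta) < 2 * delta).
apply: (@le_trans _ _ (\sum_(0 <= u < W * K) F u)%:R).
  rewrite ler_nat (big_cat_nat (leq0n N) NWK) //= leq_addr //.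
rewrite big_nat_mul natr_sum.
apply: (@le_trans _ _ (\sum_(0 <= i < W) (5 * delta / eta))).
  apply: ler_sum_nat => i _.
  rewrite -{1}[(i * K)%N]add0n big_addn mulSnr addKn.
  under eq_bigr => j _ do rewrite /F addnC natrD mulrDl addrA.
  exact: near_int_window.
rewrite sumr_const_nat subn0 -[_ *+ W]mulr_natl.
rewrite mulrA ler_pdivrMr //.
have : W%:R * K%:R <= 2 * N%:R :> R by rewrite -!natrM ler_nat.
(* There are at most [8 * N * eta] windows, each contributing at most [5 * delta / eta]: hence the
   factor 40. *)
move: (Keta4); set k := K%:R; set w : R := W%:R; set n : R := N%:R => h1 h2.
have w0 : 0 <= w by rewrite ler0n.
have d0 : 0 < delta by lra.
have h3 : w <= w * (4 * (k * eta)) by rewrite ler_peMr.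
have h4 : w * k * (4 * eta) <= 2 * n * (4 * eta) by rewrite ler_pM2r //; lra.
have h5 : w <= 8 * n * eta by lra.
have : w * (5 * delta) <= 8 * n * eta * (5 * delta) by rewrite ler_pM2r //; lra.
by lra.
Qed.

(** * Averaging over a two-level grid of cubes *)

(** In each coordinate, [u k * q' + v k] takes every value below [q * q'] exactly once. The
    condition is a conjunction over coordinates, so the count factors into one-dimensional
    counts. *)
Lemma sum_card_forall_prod (d q q' : nat) (B : 'I_d -> nat -> bool) :
  (\sum_(u : {ffun 'I_d -> 'I_q})
     #|[pred v : {ffun 'I_d -> 'I_q'} | [forall k, B k (u k * q' + v k)]]|
   = \prod_k \sum_(0 <= w < q * q') B k w)%N.
Proof.
have prodE (b : 'I_d -> bool) : (\prod_k b k = [forall k, b k] :> nat)%N.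
  have [/forallP b1|] := boolP [forall k, b k].
    by apply: big1 => k _; rewrite b1.
  rewrite negb_forall => /existsP[k /negbTE bk].
  by rewrite (bigD1 k) //= bk mul0n.
have cardE (u : {ffun 'I_d -> 'I_q}) : (#|[pred v : {ffun 'I_d -> 'I_q'} |
      [forall k, B k (u k * q' + v k)]]|
    = \sum_(v : {ffun 'I_d -> 'I_q'}) \prod_k B k (u k * q' + v k))%N.
  rewrite -sum1_card big_mkcond; apply: eq_bigr => v _.
  by rewrite prodE inE; case: [forall k, _].
rewrite (eq_bigr _ (fun u _ => cardE u)).
rewrite (eq_bigr (fun u : {ffun 'I_d -> 'I_q} =>
    \prod_k \sum_(j < q') B k (u k * q' + j)))%N.
  2: by move=> u _; rewrite bigA_distr_bigA.
rewrite -(bigA_distr_bigA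
  (fun k (i : 'I_q) => \sum_(j < q') (B k (i * q' + j) : nat))%N).
apply: eq_bigr => k _; rewrite big_nat_mul big_mkord; apply: eq_bigr => i _.
rewrite -[X in index_iota X]add0n big_addn mulSnr addKn big_mkord.
by apply: eq_bigr => j _; rewrite addnC.
Qed.

(* The margin [2 * delta] is required of the lower corner [x] of a cube so that
   [delta] is left for all of its points, see [subcube] below. *)
Definition bad (R : realType) (d h : nat) (delta : R) (tau : 'I_h -> R)
    (x : 'I_d -> R) : bool :=
  [exists i, [forall k, dist_int (x k * tau i) < 2 * delta]].

(** By [near_int_count] in each coordinate and a union bound over [tau], at most a quarter of all
    fine cells are bad. If each good [u], hence at least half of all [u], had more than half of its
    cells bad, more than a quarter would be bad. *)
Lemma good_subcell (R : realType) (d h : nat) (delta : R) (tau : 'I_h -> R)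
    (x : 'I_d -> R) (s : R) (q q' : nat) (good : pred {ffun 'I_d -> 'I_q}) :
    (0 < q)%N -> (0 < q')%N -> 16 * delta <= 1 ->
    h%:R * (40 * delta) ^+ d <= 1 / 4 ->
    (forall i, 0 < s * tau i <= delta) ->
    (forall i, 1 <= (q * q')%:R * (s * tau i)) ->
    (q ^ d <= 2 * #|good|)%N ->
  exists2 u, good u &
    (2 * #|[pred v : {ffun 'I_d -> 'I_q'} |
        bad delta tau (fun k => x k + (u k * q' + v k)%:R * s)%R]| <= q' ^ d)%N.
Proof.
move=> q0 q'0 delta16 hdelta stau qstau good2.
pose bad_at (i : 'I_h) k w := dist_int ((x k + w%:R * s) * tau i) < 2 * delta.
pose N i (u : {ffun 'I_d -> 'I_q}) := #|[pred v : {ffun 'I_d -> 'I_q'} |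
   [forall k, bad_at i k (u k * q' + v k)%N]]|.
pose Nbad (u : {ffun 'I_d -> 'I_q}) := #|[pred v : {ffun 'I_d -> 'I_q'} |
        bad delta tau (fun k => x k + (u k * q' + v k)%:R * s)]|.
have NbadE u : (Nbad u <= \sum_i N i u)%N.
  rewrite /Nbad -sum1_card big_mkcond.
  under [leqRHS]eq_bigr => i _ do rewrite /N -sum1_card big_mkcond.
  rewrite exchange_big /=; apply: leq_sum => v _.
  rewrite inE; case: ifP => // /existsP[i Hi].
  by rewrite (bigD1 i) //= inE Hi.
have sumN i : (\sum_u N i u)%:R <= ((40 * delta) ^+ d) * (q * q')%:R ^+ d.
  rewrite sum_card_forall_prod natr_prod -exprMn.
  rewrite -[X in _ <= _ ^+ X]card_ord -prodr_const; apply: ler_prod => k _.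
  rewrite ler0n /=; case/andP: (stau i) => st0 std.
  rewrite /bad_at; under eq_bigr => w _ do rewrite mulrDl -mulrA.
  exact: near_int_count.
have sumbad : 4 * (\sum_u Nbad u)%:R <= (q * q')%:R ^+ d :> R.
  apply: (@le_trans _ _ (4 * \sum_(i < h) (\sum_u N i u)%:R)).
    rewrite ler_pM2l // -natr_sum ler_nat exchange_big /=.
    by apply: leq_sum => u _.
  apply: (@le_trans _ _
      (4 * \sum_(i < h) (40 * delta) ^+ d * (q * q')%:R ^+ d)).
    by rewrite ler_pM2l //; apply: ler_sum => i _.
  rewrite sumr_const card_ord -[_ *+ h]mulr_natl.
  have Q0 : 0 <= (q * q')%:R ^+ d :> R by rewrite exprn_ge0.
  by have := ler_wpM2r Q0 hdelta; rewrite -mulrA; lra.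
have {}sumbad : (4 * \sum_u Nbad u <= q ^ d * q' ^ d)%N.
  by rewrite -expnMn -(ler_nat R) natrM natrX.
apply: contrapT => nogood.
have large u : good u -> (q' ^ d < 2 * Nbad u)%N.
  by move=> gu; rewrite ltnNge; apply/negP => le; apply: nogood; exists u.
have : (\sum_(u in good) (q' ^ d).+1 <= 2 * \sum_u Nbad u)%N.
  rewrite big_distrr /= [leqRHS](bigID good) /=.
  by apply: leq_trans (leq_addr _ _); apply: leq_sum => u gu; exact: large.
rewrite sum_nat_const.
have : (0 < q ^ d)%N by rewrite expn_gt0 q0.
have : (0 < q' ^ d)%N by rewrite expn_gt0 q'0.
by move: sumbad good2; move: (#|_|) (q ^ d)%N (q' ^ d)%N (\sum_u _)%N; nia.
Qed.

(** * Nested cubes and their common point *)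

Lemma nested_intervals (R : realType) (x s : nat -> R) :
    (forall n, 0 <= s n) -> (forall n, x n <= x n.+1) ->
    (forall n, x n.+1 + s n.+1 <= x n + s n) ->
  forall n, x n <= sup (range x) <= x n + s n.
Proof.
move=> s0 x_incr xs_decr n.
have xle := homo_leq (@lexx _ R) (@le_trans _ R) x_incr.
have xsge m p : (m <= p)%N -> x p + s p <= x m + s m.
  move=> /subnK <-; elim: (p - m)%N => // k; rewrite addSn.
  exact: le_trans (xs_decr _).
have xub m : x m <= x n + s n.
  case/orP: (leq_total m n) => [/xle le_mn|/xsge le_nm].
    by rewrite (le_trans le_mn) // lerDl.
  by apply: le_trans le_nm; rewrite lerDl.
apply/andP; split; last by apply: ge_sup => [|_ [m _ <-]]; [exists (x 0), 0|].
by apply: ub_le_sup; [exists (x n + s n) => _ [m _ <-]|exists n].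
Qed.

Section Nested_cubes.
Variables (R : realType) (d h : nat) (delta : R) (t : nat -> R).
Hypotheses (h_gt0 : (0 < h)%N) (delta_gt0 : 0 < delta).
Hypotheses (delta_small : 16 * delta <= 1).
Hypothesis h_delta : h%:R * (40 * delta) ^+ d <= 1 / 4.
Hypothesis t_ge1 : forall j, (1 <= j)%N -> 1 <= t j.
Hypothesis t_incr : forall i j, (1 <= i)%N -> (i <= j)%N -> t i <= t j.
Hypothesis t_gap :
  forall j, (1 <= j)%N -> 2 * t j <= delta * t (j + h)%N.

(* Block [b] is made of the indices b h + 1, ..., (b + 1) h. *)
Let block b (i : 'I_h) : R := t (b * h + i).+1.
Let top b : R := t (b.+1 * h)%N.
(** Number of pieces into which an edge of length [s] is cut: just enough that, across one piece,
    multiplication by a frequency of block [b] moves the value by at most [delta]. *)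
Let mesh b s : nat := (Num.trunc (s * top b / delta)).+1.

Let top_gt0 b : 0 < top b.
Proof. by rewrite (lt_le_trans ltr01) ?t_ge1 ?muln_gt0. Qed.

Let block_ge1 b i : 1 <= block b i. Proof. exact: t_ge1. Qed.

Let block_gt0 b i : 0 < block b i. Proof. exact: lt_le_trans ltr01 _. Qed.

Let block_le_top b i : block b i <= top b.
Proof. by apply: t_incr => //; rewrite mulSnr addnC -addSn addnC leq_add2l. Qed.

Let top_le_block b i : top b <= block b.+1 i.
Proof. by apply: t_incr; rewrite ?muln_gt0 // -addnS leq_addr. Qed.

Let top_gap b : 2 * top b <= delta * top b.+1.
Proof. by rewrite {2}/top mulSnr t_gap ?muln_gt0. Qed.

Let mesh_le b s : s / (mesh b s)%:R * top b <= delta.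
Proof.
rewrite mulrAC ler_pdivrMr ?ltr0n // [leRHS]mulrC -ler_pdivrMr //.
by rewrite ltW // truncnS_gt.
Qed.

(** Rounding up at most doubles [s * top b / delta], which is at least 1, so the pieces are not too
    short for the next block. *)
Let mesh_ge b s : 1 <= s * top b -> delta <= 2 * (s / (mesh b s)%:R * top b).
Proof.
move=> s_ge1; rewrite [s / _ * _]mulrAC mulrA ler_pdivlMr ?ltr0n // mulrC.
rewrite -ler_pdivlMr // -mulrA /mesh -natr1; set z := s * top b / delta.
have z_ge1 : 1 <= z.
  by rewrite ler_pdivlMr // mul1r (le_trans _ s_ge1) //; move: delta_small; lra.
have trunc_le : (Num.trunc z)%:R <= z by rewrite truncn_le (le_trans ler01).
by lra.
Qed.

(** By [1 <= s * top b], the edge spans a full period of every frequency of block [b.+1], as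
    counting for that block requires. *)
Definition half_good b (x : 'I_d -> R) (s : R) : Prop :=
  [/\ 0 < s, 1 <= s * top b &
    (2 * #|[pred v : {ffun 'I_d -> 'I_(mesh b s)} |
      bad delta (block b)
        (fun k => x k + (v k)%:R * (s / (mesh b s)%:R))%R]|
     <= mesh b s ^ d)%N].

(** Only the corner [x'] is tested, with margin [2 * delta]; the bound on [s' * top b] leaves
    [delta] on the whole cube. *)
Definition subcube b (x : 'I_d -> R) (s : R) (x' : 'I_d -> R) (s' : R) : Prop :=
  [/\ s' * top b <= delta, forall k, x k <= x' k,
      forall k, x' k + s' <= x k + s & ~~ bad delta (block b) x'].

Let half_good0 : half_good 0 (fun=> 0) 1.
Proof.
have m0 : (mesh 0 1)%:R != 0 :> R by rewrite pnatr_eq0.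
have mge0 : 0 < (mesh 0 1)%:R^-1 :> R by rewrite invr_gt0 ltr0n.
(* With [q = 1] the unit cube is its own only coarse cell. *)
have [||i|i||u _] := @good_subcell R d h delta (block 0) (fun=> 0)
  (1 / (mesh 0 1)%:R) 1 (mesh 0 1) predT _ _ delta_small h_delta => //.
- rewrite mul1r mulr_gt0 //=.
  apply: le_trans (mesh_le 0 1); rewrite mul1r ler_pM2l //.
- by rewrite mul1n mulrA mul1r mulfV // mul1r.
- by rewrite exp1n muln_gt0 /=; apply/card_gt0P; exists [ffun=> ord0].
move=> le_bad; split; rewrite // ?mul1r ?t_ge1 ?muln_gt0 //.
move: le_bad; congr (2 * _ <= _)%N; apply: eq_card => v; rewrite !inE.
apply: (congr1 (bad delta _)); apply: funext => k.
by rewrite ord1 mul0n add0n mul1r.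
Qed.

Let half_good_step b x s : half_good b x s ->
  exists x' s', half_good b.+1 x' s' /\ subcube b x s x' s'.
Proof.
move=> [s0 s_top bad_half].
set q := mesh b s in bad_half *; set s' := s / q%:R in bad_half *.
set q' := mesh b.+1 s'.
have q0 : 0 < q%:R :> R by rewrite ltr0n.
have q'0 : 0 < q'%:R :> R by rewrite ltr0n.
have s'0 : 0 < s' by rewrite divr_gt0.
have s''0 : 0 < s' / q'%:R by rewrite divr_gt0.
pose good := [pred v : {ffun 'I_d -> 'I_q} |
  ~~ bad delta (block b) (fun k => x k + (v k)%:R * s')].
have [||i|i||u good_u bad_u] := @good_subcell R d h delta (block b.+1) x
  (s' / q'%:R) q q' good _ _ delta_small h_delta => //.
- rewrite mulr_gt0 //=.
  by apply: le_trans (mesh_le b.+1 s'); rewrite ler_pM2l.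
- have -> : (q * q')%:R * (s' / q'%:R * block b.+1 i) = s * block b.+1 i.
    by rewrite natrM /s'; field; rewrite !gt_eqF.
  by rewrite (le_trans s_top) // ler_pM2l.
- pose P := [pred v : {ffun 'I_d -> 'I_q} |
    bad delta (block b) (fun k => x k + (v k)%:R * s')].
  have -> : #|good| = #|[predC P]| by apply: eq_card.
  have <- : (#|P| + #|[predC P]| = q ^ d)%N.
    by rewrite cardC card_ffun !card_ord.
  have : (2 * #|P| <= #|P| + #|[predC P]|)%N.
    by rewrite cardC card_ffun !card_ord.
  by rewrite mul2n -addnn leq_add2l mul2n -addnn leq_add2r.
exists (fun k => x k + (u k)%:R * s'), s'; split; split=> //.
(* The new side satisfies [2 * (s' * top b) >= delta], and [top] grows by at least [2 / delta] from
   one block to the next. *)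
- have := mesh_ge s_top; rewrite -/q -/s' => ge_s'.
  have gap : 2 * (s' * top b) <= delta * (s' * top b.+1).
    by rewrite mulrCA [leRHS]mulrCA ler_pM2l.
  by rewrite -(ler_pM2l delta_gt0) mulr1 (le_trans ge_s').
- move: bad_u; congr (2 * _ <= _)%N; apply: eq_card => v; rewrite !inE.
  apply: (congr1 (bad delta _)); apply: funext => k.
  rewrite natrD natrM -/q'; field; rewrite gt_eqF //.
- exact: mesh_le.
- by move=> k; rewrite lerDl mulr_ge0 // ltW.
move=> k; rewrite -addrA lerD2l.
have -> : s = q%:R * s' by rewrite mulrC divfK // gt_eqF.
by rewrite -[X in _ + X <= _]mul1r -mulrDl natr1 ler_pM2r // ler_nat.
Qed.

Lemma nested_cubes : exists alpha : 'I_d -> R,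
  forall j, (1 <= j)%N -> exists k, delta <= dist_int (alpha k * t j).
Proof.
pose state := {c : nat * ('I_d -> R) * R | half_good c.1.1 c.1.2 c.2}.
pose next (c c' : state) := (sval c').1.1 = (sval c).1.1.+1 /\
  subcube (sval c).1.1 (sval c).1.2 (sval c).2 (sval c').1.2 (sval c').2.
have next_ex (c : state) : {c' | next c c'}.
  apply: cid; case: c => -[[b x] s] good.
  have [x' [s' [good' sub']]] := half_good_step good.
  by exists (exist _ (b.+1, x', s') good').
pose start : state := exist _ (0%N, fun=> 0, 1) half_good0.
have [f [f0 fnext]] := dependent_choice next_ex start.
have fn n : (sval (f n)).1.1 = n.
  by elim: n => [|n IHn]; [rewrite f0|rewrite (fnext n).1 IHn].
pose x n := (sval (f n)).1.2; pose s n := (sval (f n)).2.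
have s_ge0 n : 0 <= s n by case: (svalP (f n)) => /ltW.
have sub n : subcube n (x n) (s n) (x n.+1) (s n.+1).
  by have [_] := fnext n; rewrite fn.
exists (fun k => sup (range (x^~ k))) => j j_gt0.
have alphaP k n : x n k <= sup (range (x^~ k)) <= x n k + s n.
  apply: (@nested_intervals R (x^~ k)) => // m; by case: (sub m).
(* Indices start at 1, so block and position come from dividing [j.-1] by [h]. *)
have jE : j = ((j.-1 %/ h) * h + Ordinal (ltn_pmod j.-1 h_gt0)).+1.
  by rewrite /= -divn_eq prednK.
set b := (_ %/ h)%N in jE; set i := Ordinal _ in jE.
have [s_top _ _] := sub b; rewrite negb_exists => /forallP/(_ i).
rewrite negb_forall => /existsP[k]; rewrite -leNgt => dist_ge.
exists k; have /andP[lo up] := alphaP k b.+1.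
have -> : t j = block b i by rewrite jE.
(* Passing from the corner of cube [b.+1] to [alpha] costs at most [delta] of the margin
   [2 * delta]. *)
have := dist_int_lipschitz (x b.+1 k * block b i)
  (sup (range (x^~ k)) * block b i).
rewrite -mulrBl normrM distrC.
rewrite (ger0_norm (ltW (block_gt0 b i))) ger0_norm ?subr_ge0 // => lip.
have : (sup (range (x^~ k)) - x b.+1 k) * block b i <= s b.+1 * top b.
  apply: ler_pM; rewrite ?subr_ge0 //; first exact: le_trans ler01 _.
  by rewrite lerBlDl.
by lra.
Qed.

End Nested_cubes.

(** * Elementary estimates for the growth of [t] *)

(** Inverting [1 - 1 / 2 <= expR (- (1 / 2))] gives [expR (1 / 2) <= 2], so [expR 1 <= 4]. *)
Lemma ln_ge1 (R : realType) (x : R) : 4 <= x -> 1 <= ln x.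
Proof.
move=> x4; rewrite -[leLHS]expRK ler_ln ?posrE ?expR_gt0 //; last by lra.
have h0 : 1 / 2 <= expR (- (1 / 2)) :> R.
  by have := expR_ge1Dx (- (1 / 2) : R); lra.
have e0 := expR_gt0 (1 / 2 : R).
have e2 : expR (1 / 2) <= 2 :> R.
  by move: h0; rewrite expRN -[(expR _)^-1]mul1r ler_pdivlMr //; lra.
have -> : 1 = 1 / 2 + 1 / 2 :> R by lra.
by rewrite expRD; nra.
Qed.

(** Invert [1 - 1 / (x + 1) <= expR (- (1 / (x + 1)))], whose left side is the inverse of
    [1 + 1 / x]. *)
Lemma expR_le_1DV (R : realType) (x : R) :
  0 < x -> expR (1 / (x + 1)) <= 1 + 1 / x.
Proof.
move=> x0; have x'0 : 0 < 1 + 1 / x by rewrite addr_gt0 ?divr_gt0.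
rewrite -lef_pV2 ?posrE ?expR_gt0 // -expRN.
apply: le_trans (expR_ge1Dx _); rewrite le_eqVlt; apply/orP; left; apply/eqP.
by field; rewrite !gt_eqF //; lra.
Qed.

Lemma lacunary_iter (R : realType) (r : R) (t : nat -> R) (j n : nat) :
    0 <= r -> (1 <= j)%N ->
    (forall i, (1 <= i)%N -> r * t i <= t i.+1) ->
  r ^+ n * t j <= t (j + n)%N.
Proof.
move=> r0 j1 step; elim: n => [|n IHn]; first by rewrite mul1r addn0.
rewrite addnS exprS -mulrA.
apply: le_trans (step _ _); last by rewrite ltn_addr.
exact: ler_wpM2l.
Qed.

(** * Choice of the parameters *)

Theorem theorem1 (R : realType) (d : nat) (d_gt0 : (0 < d)%N)
    (M : R) (M_ge8 : 8 <= M) (t : nat -> R)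
    (t_gt0 : forall j : nat, (1 <= j)%N -> 0 < t j)
    (t1_ge2 : 2 <= t 1%N)
    (t_lacunary : forall j : nat, (1 <= j)%N -> 1 + 1 / M <= t j.+1 / t j) :
  exists alpha : 'I_d -> R, forall j : nat, (1 <= j)%N ->
    1 / (2 ^+ 11 * (M * ln M) `^ (1 / d%:R))
      <= \big[Num.max/0]_(k < d) dist_int (alpha k * t j).
Proof.
have M0 : 0 < M by lra.
have L1 : 1 <= ln M by apply: ln_ge1; lra.
have LM : ln M <= M.
  have := @le_ln1Dx R (M - 1); rewrite (_ : 1 + (M - 1) = M); last by ring.
  by move=> /(_ _)/le_trans; apply; lra.
set X := M * ln M; set Y := X `^ (1 / d%:R).
have X8 : 8 <= X by rewrite /X; nra.
have XM : X <= M ^+ 2 by rewrite expr2 ler_pM2l.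
have d1 : 1 <= d%:R :> R by rewrite ler1n.
have Y1 : 1 <= Y.
  by rewrite -(powRr0 X); apply: ler_powR; [lra|rewrite divr_ge0 //; lra].
have Y0 : 0 < Y by exact: lt_le_trans ltr01 Y1.
have YX : Y <= X.
  rewrite -[leRHS]powRr1; last lra.
  by apply: ler_powR; [lra|rewrite ler_pdivrMr; lra].
have Yd : Y ^+ d = X.
  rewrite -powR_mulrn ?(le_trans ler01) // -powRrM divfK ?powRr1 //; first lra.
  by rewrite gt_eqF //; lra.
set delta := 1 / _.
have deltaY : 256 * (delta * Y) = 1 / 8.
  by rewrite /delta; field; rewrite gt_eqF //; lra.
have delta0 : 0 < delta by rewrite divr_gt0 // mulr_gt0 //; lra.
clearbody delta.
have step j : (1 <= j)%N -> (1 + 1 / M) * t j <= t j.+1.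
  by move=> j1; rewrite -ler_pdivlMr ?t_gt0 // t_lacunary.
have V0 : 0 < 1 / M by rewrite divr_gt0.
have t_incr i j : (1 <= i)%N -> (i <= j)%N -> t i <= t j.
  move=> i1 /subnKC <-; rewrite -[leLHS]mul1r -[in leLHS](expr1n R (j - i)).
  apply: lacunary_iter => // k k1; rewrite mul1r.
  by apply: le_trans (step _ k1); have := t_gt0 _ k1; nra.
(* The factor 7 gives [6 * (M + 1) * ln M <= h], hence growth by [M ^+ 6] over a block; [h <= 8 * X]
   keeps the union bound small. *)
set h := (Num.trunc (7 * X)).+1.
have h_le : h%:R <= 8 * X.
  have : (Num.trunc (7 * X))%:R <= 7 * X by rewrite truncn_le; lra.
  by rewrite (_ : h%:R = (Num.trunc (7 * X))%:R + 1) ?natr1 //; lra.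
have h_ge : 7 * X <= h%:R by rewrite ltW // truncnS_gt.
have h_gt0 : (0 < h)%N by [].
clearbody h.
have growth : 2 <= delta * (1 + 1 / M) ^+ h.
  have M6 : M ^+ 6 <= (1 + 1 / M) ^+ h.
    apply: (@le_trans _ _ (expR (1 / (M + 1)) ^+ h)); last first.
      by apply: lerXn2r; rewrite ?nnegrE ?expR_ge0 ?expR_le_1DV //; lra.
    rewrite -[in leLHS](@lnK _ M) ?posrE // -!expRM_natl ler_expR.
    rewrite mulrA mulr1 ler_pdivlMr; last lra.
    by apply: le_trans h_ge; rewrite /X; nra.
  have M2 : 64 <= M ^+ 2 by rewrite expr2; nra.
  have M4 : 64 * 64 <= M ^+ 2 * M ^+ 2 by exact: ler_pM.
  (* Here [M ^+ 4 >= 2 ^+ 12] and [M ^+ 2 >= X >= Y], while [delta * Y] is [1 / 2 ^+ 11]: the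
     product is exactly 2. *)
  have : delta * (64 * 64 * Y) <= delta * (1 + 1 / M) ^+ h.
    rewrite ler_pM2l //; apply: le_trans M6.
    rewrite (_ : M ^+ 6 = M ^+ 2 * M ^+ 2 * M ^+ 2); last by rewrite -!exprD.
    by apply: (ler_pM _ (ltW Y0) M4 (le_trans YX XM)); rewrite mulr_ge0.
  by apply: le_trans; lra.
have [||j j1||j j1|alpha alphaP] := @nested_cubes R d h delta t h_gt0 delta0.
- have : delta <= delta * Y by rewrite ler_peMr // ltW.
  by lra.
(* Since [40 / 2 ^+ 11 = 5 / 256] and [Y ^+ d = X], the left side is [h * c ^+ d / X], at most
   [8 * c <= 5 / 32]. *)
- have [c [c0 c_le ->]] :
      exists c, [/\ 0 <= c, c <= 5 / 256 & 40 * delta = c / Y].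
    exists (5 / 256); split; [lra|lra|].
    apply: (mulIf (lt0r_neq0 Y0)); rewrite divfK ?lt0r_neq0 //.
    by lra.
  rewrite expr_div_n Yd mulrA ler_pdivrMr; last by lra.
  have : c ^+ d <= c by rewrite -[leRHS]expr1; apply: ler_wiXn2l => //; lra.
  have : 0 <= c ^+ d by rewrite exprn_ge0.
  by set p := _ ^+ d; nra.
- by apply: (@le_trans _ _ 2); [lra|exact: le_trans t1_ge2 (t_incr _ _ _ j1)].
- exact: t_incr.
- have := lacunary_iter h _ j1 step; have := t_gt0 _ j1; move: growth.
  by nra.
exists alpha => j /alphaP[k]; move=> /le_trans; apply.
exact: (le_bigmax _ (fun k => dist_int (alpha k * t j)) k).
Qed.
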